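(* Let $\varphi:G\times X\to X$ be an equicontinuous action of a finitely generated group $G$ on a compact metric space $(X,d)$. Then: (1) $\overline{\mathcal{M}_{\beta}(X,\varphi)}=\mathcal{M}_{\beta}(X,\varphi)$; (2) for every Borel probability measure $\mu$ on $X$, $\mu(Persis_\beta(\varphi))=1$ if and only if $\mu\in\mathcal{M}_\beta(X,\varphi)$.
   Context: Actions are continuous, $G$ has the discrete topology, and $S$ is a fixed finite generating set of $G$. The action $\varphi$ is equicontinuous if every $x\in X$ is an equicontinuous point: for every $\epsilon>0$ there is $\delta_x>0$ such that $d(x,y)<\delta_x$ implies $d(\varphi(g,x),\varphi(g,y))<\epsilon$ for all $g\in G$. For continuous actions $\varphi,\psi$ of $G$ on $X$ put $d_S(\varphi,\psi)=\sup\{d(\varphi(s,x),\psi(s,x)): x\in X, s\in S\}$. $Persis_\beta(\varphi)$ is the set of $\beta$-persistent points: $x\in X$ such that for every $\epsilon>0$ there is $\delta>0$ such that for every continuous action $\psi:G\times X\to X$ with $d_S(\varphi,\psi)<\delta$ there is $y\in X$ with $d(\varphi(g,x),\psi(g,y))<\epsilon$ for all $g\in G$. $B(\epsilon,\psi,\varphi)$ is the set of $x\in X$ for which there is $y\in X$ with $d(\psi(g,y),\varphi(g,x))\le\epsilon$ for all $g\in G$. $\mathcal{M}(X)$ is the set of Borel probability measures on $X$ with the weak$^*$ topology, in which closures of sets of measures are taken. $\mathcal{M}_\beta(X,\varphi)$ is the set of $\mu\in\mathcal{M}(X)$ such that for every $\epsilon>0$ there is $\delta>0$ such that for every Borel $A\subseteq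 X$ with $\mu(A)>0$ one has $A\cap B(\epsilon,\psi,\varphi)\neq\emptyset$ for every continuous action $\psi:G\times X\to X$ with $d_S(\varphi,\psi)<\delta$. *)

(* Defs.v *)
From HB Require Import structures.
From mathcomp Require Import all_boot all_order all_algebra.
From mathcomp Require Import all_classical all_reals all_analysis.

Set Implicit Arguments.
Unset Strict Implicit.
Unset Printing Implicit Defensive.

Import Order.TTheory GRing.Theory Num.Theory.
Import numFieldNormedType.Exports.

Local Open Scope classical_set_scope.
Local Open Scope ring_scope.

(* The library's measurable types are pointed, so Borel measures on X require
   a distinguished point of X. *)
#[short(type="pmetricType")]
HB.structure Definition PointedMetric (K : numDomainType) :=
  { M of Metric K M & Pointed M }.

Definition generating (G : groupType) (S : set G) : Prop :=
  forall H : {pred G}, group_closed H ->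
    (forall s, S s -> s \in H) -> forall g, g \in H.

Record continuous_action (G : groupType) (X : topologicalType) :=
  ContinuousAction {
    act :> G -> X -> X;
    act1g : forall x, act 1%g x = x;
    actMg : forall g h x, act (g * h)%g x = act g (act h x);
    act_continuous :
      continuous (fun p : (discrete_topology G * X)%type => act p.1 p.2)
  }.

Section dynamics.
Context {R : realType} {G : groupType} {X : metricType R}.
Implicit Types (phi psi : continuous_action G X) (S : set G).

Definition equicontinuous_point phi (x : X) : Prop :=
  forall e : R, 0 < e -> exists2 d : R, 0 < d &
    forall y, mdist x y < d -> forall g, mdist (phi g x) (phi g y) < e.

Definition equicontinuous_action phi : Prop :=
  forall x, equicontinuous_point phi x.

(* On a compact X the set is bounded; if S is empty then d_S = sup set0 = 0. *)
Definition action_dist S phi psi : R :=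
  sup [set mdist (phi s x) (psi s x) | s in S & x in [set: X]].

Definition persis S phi : set X :=
  [set x | forall e : R, 0 < e -> exists2 d : R, 0 < d &
    forall psi, action_dist S phi psi < d ->
      exists y, forall g, mdist (phi g x) (psi g y) < e].

Definition shadowed (e : R) psi phi : set X :=
  [set x | exists y, forall g, mdist (psi g y) (phi g x) <= e].

End dynamics.

Definition borel (X : ptopologicalType) := g_sigma_algebraType (@open X).

Section measures.
Context {R : realType} {G : groupType} {X : pmetricType R}.

Definition integration (mu : probability (borel X) R) :
    {ptws continuousType X R -> R} :=
  fun f => \int[mu]_x f x.

(* The coarsest topology making mu |-> \int f dmu continuous for every
   continuous f : X -> R. Two elements that agree on Borel sets are
   topologically indistinguishable: a library measure is a function on all
   subsets, whose values outside the sigma-algebra carry no information. *)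
Definition weak_star := initial_topology integration.

Definition persistent_measures (S : set G) (phi : continuous_action G X) :
    set weak_star :=
  [set mu : probability (borel X) R |
    forall e : R, 0 < e -> exists2 d : R, 0 < d &
      forall A : set (borel X), measurable A -> (0 < mu A)%E ->
        forall psi : continuous_action G X, action_dist S phi psi < d ->
          A `&` shadowed e psi phi !=set0].

End measures.

(* Main.v *)
Require Import Defs.
From HB Require Import structures.
From mathcomp Require Import all_boot all_order all_algebra.
From mathcomp Require Import all_classical all_reals all_analysis.
From mathcomp Require Import measurable_realfun.

(** Equicontinuity spreads persistence from a point to its neighbours: if [x]
    and [y] are close enough, their whole [phi]-orbits stay close, so an orbit
    of [psi] that follows the orbit of [y] also follows the orbit of [x], up to
    a slightly larger error.  Since [X] is compact, finitely many open sets
    whose points have uniformly close orbits cover [X]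
    ([equicontinuous_cover]), and everything is read off this cover.

    The set of persistent points is closed ([closed_persis]), hence Borel.  If
    it has full measure, a set of positive measure meets it, and one [delta]
    serves all persistent points at a given scale ([persis_uniform]); so the
    measure is persistent.  Conversely, let [mu] be persistent and fix a scale.
    An open set of the cover with positive measure contains, for every small
    perturbation, a shadowed point, so all its points are persistent at that
    scale; the points that are not lie in the finitely many null sets of the
    cover ([negligible_not_persis_at]).  Letting the scale run through the
    [1 / n.+1] gives the second claim ([persistent_measuresP]).

    The persistent measures are thus those that give full measure to a fixed
    closed set [F].  Such measures form a weak-star closed set
    ([weak_star_closed_full]): for a continuous [f] with values in [0, 1] that
    vanishes exactly on [F], they are the measures [mu] with [\int f dmu = 0],
    which is a closed condition. *)

Set Implicit Arguments.
Unset Strict Implicit.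
Unset Printing Implicit Defensive.

Import Order.TTheory GRing.Theory Num.Theory.
Import numFieldNormedType.Exports.

Local Open Scope classical_set_scope.
Local Open Scope ring_scope.

(** * Borel sets and sets of full measure *)

Lemma open_borel (X : ptopologicalType) (U : set X) :
  open U -> measurable (U : set (borel X)).
Proof. exact: sub_sigma_algebra. Qed.

Lemma closed_borel (X : ptopologicalType) (F : set X) :
  closed F -> measurable (F : set (borel X)).
Proof.
move=> cF; rewrite -[F]setCK; apply: measurableC; apply: open_borel.
exact: closed_openC.
Qed.

Lemma continuous_borel (R : realType) (X : ptopologicalType) (f : X -> R) :
  continuous f -> measurable_fun [set: borel X] (f : borel X -> R).
Proof.
move=> /continuousP cf; apply: (measurability _ (RGenOpens.measurableE R)).
move=> _ [_ [a [b ->] <-]]; rewrite setTI; apply: open_borel.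
exact/cf/interval_open.
Qed.

Lemma negligible_setCP (R : realType) d (T : measurableType d)
    (P : probability T R) (F : set T) :
  measurable F -> P.-negligible (~` F) <-> P F = 1%E.
Proof.
move=> mF; have mFC := measurableC mF.
have PC : P (~` F) = (1 - P F)%E by exact: probability_setC.
split=> [/(negligibleP _ mFC) PC0|PF]; last first.
  by apply/(negligibleP _ mFC); rewrite [LHS]PC PF subee.
have /eqP : (1 - P F = 0)%E by rewrite -PC.
by rewrite sube_eq// add0e => /eqP.
Qed.

(** The upper bound on [f] guarantees that its integral is finite; the real
    integral of a function with infinite integral is [0] by convention. *)
Lemma Rintegral_eq0P (R : realType) d (T : measurableType d)
    (P : probability T R) (f : T -> R) :
  measurable_fun setT f -> (forall x, 0 <= f x <= 1) ->
  \int[P]_x f x = 0 <-> P [set x | f x = 0] = 1%E.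
Proof.
move=> mf f01.
have mEf : measurable_fun setT (EFin \o f) by exact/measurable_EFinP.
have f_ge0 x : 0 <= f x by case/andP: (f01 x).
have m0 : measurable [set x | f x = 0].
  rewrite -[X in measurable X]setTI.
  exact: (mf measurableT _ (measurable_set1 0)).
have intf : (\int[P]_x (f x)%:E)%E \is a fin_num.
  apply: integrable_fin_num => //; apply: measurable_bounded_integrable => //.
    by rewrite (le_lt_trans (probability_le1 _ _))// ltry.
  exists 1; split=> // M M1 x _ /=; rewrite ger0_norm// (le_trans _ (ltW M1))//.
  by case/andP: (f01 x).
have normf : (\int[P]_x `|(f x)%:E| = \int[P]_x (f x)%:E)%E.
  by apply: eq_integral => x _; rewrite gee0_abs// lee_fin.
have aeP := ae_eq_integral_abs P measurableT mEf.
have zeroE : [set x | setT x -> (EFin \o f) x = cst 0%E x] = [set x | f x = 0].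
  by apply/seteqP; split=> x /=; [move=> /(_ I)[]|move=> ->].
have aeE : ae_eq P setT (EFin \o f) (cst 0%E) =
    P.-negligible (~` [set x | f x = 0]) by rewrite -zeroE.
rewrite /Rintegral; split.
  move=> If; apply/(negligible_setCP _ m0).
  have /aeP : (\int[P]_x `|(EFin \o f) x| = 0)%E.
    by rewrite normf -(fineK intf) If.
  by rewrite aeE.
move=> /(negligible_setCP _ m0) N0.
have /aeP : ae_eq P setT (EFin \o f) (cst 0%E) by rewrite aeE.
by rewrite normf => ->.
Qed.

(** * Weak-star closedness of full measure on a closed set *)

(** The function is the distance to [F], truncated at [1]; the truncation also
    covers an empty [F], whose distance to every point is infinite. *)
Lemma closed_zero_set (R : realType) (X : pseudoMetricType R) (F : set X) :
  closed F -> exists f : X -> R,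
    [/\ continuous f, forall x, 0 <= f x <= 1 & forall x, f x = 0 <-> F x].
Proof.
move=> cF; pose h x := mine (edist_inf F x) 1%E.
have hge0 x : (0 <= h x)%E by rewrite le_min edist_inf_ge0/= lee01.
have hle1 x : (h x <= 1)%E by rewrite ge_min lexx orbT.
have hfin x : h x \is a fin_num.
  by rewrite ge0_fin_numE// (le_lt_trans (hle1 x))// ltry.
exists (fine \o h); split.
- move=> x; apply: fine_cvg; rewrite /= fineK//.
  have /(_ x) := min_fun_continuous (@edist_inf_continuous _ _ F)
    (@cst_continuous X _ 1%E).
  exact.
- by move=> x /=; rewrite fine_ge0//= -lee_fin fineK.
- move=> x /=; split=> [hx0|Fx]; last first.
    by rewrite /h edist_inf0// /mine lte01.
  have {}hx0 : h x = 0%E by rewrite -(fineK (hfin x)) hx0.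
  apply: cF => B /nbhs_ballP[e /= e0 eB].
  have [_ [a Fa <-] xa] :
      exists2 y, [set edist (x, a) | a in F] y & (y < e%:E)%E.
    apply: ereal_inf_lt; rewrite -/(edist_inf F x); move: hx0; rewrite /h.
    case: (ltP (edist_inf F x) 1%E) => [_ ->|_ /eqP]; first by rewrite lte_fin.
    by rewrite onee_eq0.
  by exists a; split=> //; exact/eB/(edist_lt_ball xa).
Qed.

Lemma weak_star_closed_full (R : realType) (X : pmetricType R) (F : set X) :
  closed F ->
  closed [set mu : weak_star | (mu : probability (borel X) R) F = 1%E].
Proof.
move=> cF; have [f [cf f01 f0]] := closed_zero_set cF.
have mf := continuous_borel cf.
have FE : F = [set x | f x = 0] by apply/seteqP; split=> x /= /f0.
pose fc : continuousType X R := mkcts cf.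
pose ev : @weak_star R X -> R := proj fc \o @integration R X.
have cev : continuous ev.
  move=> mu.
  apply: (@continuous_comp (@weak_star R X) {ptws continuousType X R -> R} R).
    exact: initial_continuous.
  exact: proj_continuous.
rewrite [X in closed X](_ : _ = ev @^-1` [set 0]).
  by apply: preimage_closed => //; exact: closed_eq.
by rewrite FE; apply/seteqP; split=> mu /= /(Rintegral_eq0P _ mf f01).
Qed.

(** * Persistence and equicontinuity *)

Section persistence.
Context {R : realType} {G : groupType} {X : pmetricType R}.
Implicit Types (S : set G) (phi psi : continuous_action G X).

Definition persis_at S phi (e : R) : set X :=
  [set x | exists2 d : R, 0 < d &
    forall psi, action_dist S phi psi < d ->
      exists y, forall g, mdist (phi g x) (psi g y) < e].

(** Countably many scales suffice, which makes persistence accessible to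
    measures. *)
Lemma persis_bigcap S phi :
  persis S phi = \bigcap_n persis_at S phi n.+1%:R^-1.
Proof.
apply/seteqP; split=> [x Px n _|x Px e e0]; first exact: Px.
have [n _ /(_ n (leqnn n)) /= ne] := near_infty_natSinv_lt (PosNum e0).
have [d d0 xd] := Px n I; exists d => // psi /xd[y xy].
by exists y => g; exact: lt_trans (xy g) ne.
Qed.

(** The [delta] of a nearby persistent point serves at a limit point, half of
    [e] being spent on the distance between the two orbits. *)
Lemma closed_persis S phi : equicontinuous_action phi -> closed (persis S phi).
Proof.
move=> ec x clx e e0.
have e20 : 0 < e / 2 by rewrite divr_gt0.
have [r r0 xr] := ec x _ e20.
have [y [Py]] := clx _ (nbhsx_ballx x r r0).
rewrite ballEmdist /= => /xr xy.
have [d d0 yd] := Py _ e20; exists d => // psi /yd[z yz].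
exists z => g; rewrite (splitr e).
exact: le_lt_trans (metric_triangle _ _ _) (ltrD (xy g) (yz g)).
Qed.

Lemma equicontinuous_cover phi (e : R) :
  compact [set: X] -> equicontinuous_action phi -> 0 < e ->
  exists (U : X -> set X) (D : seq X),
    [/\ forall x, open (U x),
        forall x y z g, U x y -> U x z -> mdist (phi g y) (phi g z) < e
      & forall y, exists2 x, x \in D & U x y].
Proof.
move=> cX ec e0.
have e20 : 0 < e / 2 by rewrite divr_gt0.
pose r x := sval (cid2 (ec x _ e20)).
have r0 x : 0 < r x by rewrite /r; case: cid2.
have rP x y g : mdist x y < r x -> mdist (phi g x) (phi g y) < e / 2.
  by rewrite /r; case: cid2 => /= d _ + xy; exact.
pose U x := (ball x (r x))°.
have oU x : open (U x) by exact: open_interior.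
move: cX; rewrite compact_cover => /(_ X setT U (fun x _ => oU x))[].
  by move=> x _; exists x => //; exact: nbhsx_ballx.
move=> D _ cD; exists U, (finmap.enum_fset D); split=> //.
  move=> x y z g /interior_subset + /interior_subset.
  rewrite ballEmdist /= => /rP-/(_ g) xy /rP-/(_ g) xz.
  rewrite (splitr e) (le_lt_trans (metric_triangle _ (phi g x) _))//.
  by rewrite ltrD// metric_sym.
by move=> y; have [x xD xy] := cD y I; exists x.
Qed.

(** Each set of the cover that contains a persistent point [p] borrows the
    [delta] of [p]; finitely many of them have a positive minimum. *)
Lemma persis_uniform S phi (e : R) :
  compact [set: X] -> equicontinuous_action phi -> 0 < e ->
  exists2 d : R, 0 < d & forall psi, action_dist S phi psi < d ->
    persis S phi `<=` shadowed e psi phi.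
Proof.
move=> cX ec e0.
have e20 : 0 < e / 2 by rewrite divr_gt0.
have [U [D [_ Ue UD]]] := equicontinuous_cover cX ec e20.
have /choice[d dP] : forall x, exists d : R, 0 < d /\
    forall psi, action_dist S phi psi < d ->
      U x `&` persis S phi `<=` shadowed e psi phi.
  move=> x; have [[p [Up Pp]]|/set0P/negP/negPn/eqP UP0] :=
    pselect (U x `&` persis S phi !=set0); last first.
    by exists 1; split=> // psi _; rewrite UP0.
  have [d d0 pd] := Pp _ e20; exists d; split=> // psi /pd[y py] z [Uz _].
  exists y => g; apply: ltW; rewrite metric_sym (splitr e).
  exact: le_lt_trans (metric_triangle _ _ _) (ltrD (Ue _ _ _ g Uz Up) (py g)).
exists (\big[Num.min/1]_(x <- D) d x).
  by apply: lt_bigmin => // x _; case: (dP x).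
move=> psi psid z Pz; have [x xD Uz] := UD z.
have [_ /(_ psi)] := dP x; apply; last by split.
by apply: lt_le_trans psid _; exact: ge_bigmin_seq.
Qed.

(** * Persistent measures *)

(** Persistence of [mu] is applied only to the sets of the cover: the shadowed
    point it provides may depend on [psi], but it stays in the same set, so
    all points of that set are shadowed. *)
Lemma negligible_not_persis_at S phi (mu : probability (borel X) R) (e : R) :
  compact [set: X] -> equicontinuous_action phi ->
  persistent_measures S phi mu -> 0 < e ->
  mu.-negligible (~` persis_at S phi e : set (borel X)).
Proof.
move=> cX ec Mmu e0.
have e20 : 0 < e / 2 by rewrite divr_gt0.
have [U [D [oU Ue UD]]] := equicontinuous_cover cX ec e20.
have [d d0 dP] := Mmu _ e20.
pose V x : set (borel X) := if mu (U x) == 0%E then U x else set0.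
apply: (@negligibleS _ _ _ _ (\big[setU/set0]_(x <- D) V x)); last first.
  elim/big_ind : _ => //; first exact: negligible_set0.
    by move=> A B; exact: negligibleU.
  move=> x _; rewrite /V; case: eqP => [mU0|_]; last exact: negligible_set0.
  by apply/negligibleP => //; exact: open_borel.
move=> y nPy; rewrite -bigcup_seq /=; have [x xD Uy] := UD y; exists x => //.
rewrite /V; case: eqP => // /eqP mU; exfalso; apply: nPy.
exists d => // psi /(dP (U x)) []; first exact: open_borel.
  by rewrite lt0e mU measure_ge0.
move=> z [Uz [w wz]]; exists w => g.
rewrite (splitr e) (le_lt_trans (metric_triangle _ (phi g z) _))//.
by apply: ltr_leD; [exact: Ue Uy Uz|rewrite metric_sym].
Qed.

Lemma persistent_measuresP S phi (mu : probability (borel X) R) :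
  compact [set: X] -> equicontinuous_action phi ->
  mu (persis S phi) = 1%E <-> persistent_measures S phi mu.
Proof.
move=> cX ec.
have mP : measurable (persis S phi : set (borel X)).
  by apply: closed_borel; exact: closed_persis.
split=> [muP e e0|Mmu].
  have [d d0 dP] := persis_uniform S cX ec e0.
  exists d => // A mA A0 psi /dP Psub; apply/set0P/eqP => AB0.
  have AP : A `<=` ~` persis S phi.
    move=> x Ax /Psub xB.
    by have : (A `&` shadowed e psi phi) x by []; rewrite AB0.
  have : (mu A <= mu (~` persis S phi : set (borel X)))%E.
    by apply: le_measure => //; rewrite inE//; exact: measurableC.
  by rewrite probability_setC// muP subee// leNgt A0.
apply/(negligible_setCP _ mP); rewrite persis_bigcap setC_bigcap.
apply: negligible_bigcup => n.
exact: negligible_not_persis_at.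
Qed.

End persistence.

Theorem proposition3p14 (R : realType) (G : groupType) (S : set G)
    (X : pmetricType R) (phi : continuous_action G X) :
  finite_set S -> generating S ->
  compact [set: X] ->
  equicontinuous_action phi ->
  closure (persistent_measures S phi) = persistent_measures S phi /\
  (forall mu : probability (borel X) R,
     mu (persis S phi) = 1%E <-> persistent_measures S phi mu).
Proof.
move=> _ _ cX ec.
have MP mu := persistent_measuresP S mu cX ec.
split=> //; apply/esym/closure_id.
rewrite [X in closed X](_ : _ =
    [set mu : weak_star | (mu : probability (borel X) R) (persis S phi) = 1%E]).
  exact/weak_star_closed_full/closed_persis.
by apply/seteqP; split=> mu /MP.
Qed.
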